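(* Let $k,s\geq 2$ be integers. Then there exists a constant $C_{s,k}$ such that for every positive integer $n$, $$\mathrm{ex}^*(n,C_{2k},s)\leq C_{s,k}\, n^{1+1/k}.$$
   Context: $C_{2k}$ denotes the cycle of length $2k$. For a graph $H$ and integers $n,s\geq 1$, $\mathrm{ex}^*(n,H,s)$ denotes the maximum number of edges in an $n$-vertex graph which contains no copy of $K_{s,s}$ as a (not necessarily induced) subgraph and contains no induced copy of $H$. *)

(* Defs.v *)
From mathcomp Require Import all_boot.
Set Implicit Arguments. Unset Strict Implicit. Unset Printing Implicit Defensive.

Definition simple_graph (n : nat) (E : {set 'I_n * 'I_n}) : bool :=
  [forall x : 'I_n, forall y : 'I_n, ((x, y) \in E) == ((y, x) \in E)] &&
  [forall x : 'I_n, (x, x) \notin E].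

Definition nedges (n : nat) (E : {set 'I_n * 'I_n}) : nat :=
  #|[set p in E | (p.1 < p.2)%N]|.

Definition contains_Kss (n s : nat) (E : {set 'I_n * 'I_n}) : bool :=
  [exists A : {set 'I_n}, exists B : {set 'I_n},
    [&& #|A| == s, #|B| == s, [disjoint A & B] &
        [forall a in A, forall b in B, (a, b) \in E]]].

Definition contains_induced (m n : nat) (H : {set 'I_m * 'I_m})
  (G : {set 'I_n * 'I_n}) : bool :=
  [exists f : {ffun 'I_m -> 'I_n}, injectiveb f &&
    [forall i : 'I_m, forall j : 'I_m, ((i, j) \in H) == ((f i, f j) \in G)]].

Definition cycle_graph (m : nat) : {set 'I_m * 'I_m} :=
  [set p : 'I_m * 'I_m | (val p.2 == (val p.1).+1 %% m) || (val p.1 == (val p.2).+1 %% m)].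

Definition ex_star (n : nat) (m : nat) (H : {set 'I_m * 'I_m}) (s : nat) : nat :=
  \max_(E : {set 'I_n * 'I_n} | simple_graph E && ~~ contains_Kss s E
                                && ~~ contains_induced H E) nedges E.

(* Main.v *)
Require Import Defs.
From mathcomp Require Import all_boot all_order all_algebra ring lra zify.
From mathcomp Require Import Rstruct.
Set Implicit Arguments. Unset Strict Implicit. Unset Printing Implicit Defensive.
Import Order.TTheory GRing.Theory Num.Theory.

(* Pass to an induced subgraph whose minimum degree d is at least the edge density,
   and sample a closed walk of length 2k with probability proportional to the
   product of the inverse degrees of its vertices. The total weight h_k is the
   squared Frobenius norm of the k-th power of the symmetrized transition matrix;
   h_k >= 1 because 1 is an eigenvalue, h_0 is the number of vertices n, and h is
   log-convex. By the Cauchy-Schwarz inequality two given positions coincide with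
   probability at most (h_(k-1) / (d h_k))^(1/2) <= (n / d^k)^(1/2k).
   Two given non-consecutive positions are rarely adjacent either: conditioning on
   an antipodal pair of vertices that separates them makes them independent, so a
   frequent adjacency, together with the rarity of coincidences, would produce a
   K_{s,s} as in the Kovari-Sos-Turan theorem. Hence if d^k exceeds a constant
   multiple of n, some closed walk has neither coincidences nor chords, and it is
   an induced cycle of length 2k. *)

(** * Cauchy-Schwarz, power means and collisions of independent samples *)

Section Inequalities.
Variable R : rcfType.
Local Open Scope ring_scope.

(** Lagrange's identity: twice the difference of the two sides is a sum of squares. *)
Lemma cauchy_schwarz (I : finType) (u v : I -> R) :
  (\sum_i u i * v i) ^+ 2 <= (\sum_i u i ^+ 2) * (\sum_i v i ^+ 2).
Proof.
rewrite -subr_ge0 -(pmulr_rge0 _ (ltr0n R 2)).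
suff -> : 2%:R * ((\sum_i u i ^+ 2) * (\sum_i v i ^+ 2) -
    (\sum_i u i * v i) ^+ 2) = \sum_i \sum_j (u i * v j - u j * v i) ^+ 2.
  by apply: sumr_ge0 => i _; apply: sumr_ge0 => j _; apply: sqr_ge0.
have -> : \sum_i \sum_j (u i * v j - u j * v i) ^+ 2 =
    \sum_i \sum_j (u i ^+ 2 * v j ^+ 2 + v i ^+ 2 * u j ^+ 2
                  - (2%:R * (u i * v i)) * (u j * v j)).
  by apply: eq_bigr => i _; apply: eq_bigr => j _; ring.
rewrite (eq_bigr _ (fun i _ => sumrB _ _ _ _)) sumrB.
rewrite (eq_bigr _ (fun i _ => big_split _ _ _ _ _)) big_split /=.
by rewrite -!big_distrlr -mulr_sumr /=; ring.
Qed.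

Lemma cauchy_schwarz_dom (I : finType) (u v a : I -> R) :
  (forall i, u i ^+ 2 <= a i) ->
  (\sum_i u i * v i) ^+ 2 <= (\sum_i a i) * (\sum_i v i ^+ 2).
Proof.
move=> ua; apply: le_trans (cauchy_schwarz u v) _.
by rewrite ler_wpM2r ?ler_sum// sumr_ge0 // => i _; apply: sqr_ge0.
Qed.

(** Twice the difference is the sum over all pairs of [p i * p j * ((x i ^+ a - x j ^+ a) * (x i - x
    j))], where the two differences never have opposite signs. *)
Lemma chebyshev_sum (I : finType) (p x : I -> R) (a : nat) :
  (forall i, 0 <= p i) -> (forall i, 0 <= x i) ->
  (\sum_i p i * x i ^+ a) * (\sum_i p i * x i) <=
  (\sum_i p i) * (\sum_i p i * x i ^+ a.+1).
Proof.
move=> p0 x0; rewrite -subr_ge0 -(pmulr_rge0 _ (ltr0n R 2)).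
suff -> : 2%:R * ((\sum_i p i) * (\sum_i p i * x i ^+ a.+1) -
    (\sum_i p i * x i ^+ a) * (\sum_i p i * x i)) =
    \sum_i \sum_j p i * p j * ((x i ^+ a - x j ^+ a) * (x i - x j)).
  apply: sumr_ge0 => i _; apply: sumr_ge0 => j _.
  apply: mulr_ge0; first exact: mulr_ge0.
  wlog le_ij : i j / x j <= x i.
    move=> H; case: (leP (x j) (x i)) => [|/ltW] le; first exact: H.
    by rewrite -mulrNN !opprB; apply: H.
  by rewrite mulr_ge0 // subr_ge0 // lerXn2r // nnegrE.
have -> : \sum_i \sum_j p i * p j * ((x i ^+ a - x j ^+ a) * (x i - x j)) =
    \sum_i \sum_j ((p i * x i ^+ a.+1) * p j + p i * (p j * x j ^+ a.+1)
     - ((p i * x i ^+ a) * (p j * x j) + (p i * x i) * (p j * x j ^+ a))).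
  by apply: eq_bigr => i _; apply: eq_bigr => j _; rewrite !exprS; ring.
rewrite (eq_bigr _ (fun i _ => sumrB _ _ _ _)) sumrB.
rewrite !(eq_bigr _ (fun i _ => big_split _ _ _ _ _)) !big_split /=.
by rewrite -!big_distrlr /=; ring.
Qed.

Lemma power_mean (I : finType) (p x : I -> R) (a : nat) :
  (forall i, 0 <= p i) -> (forall i, 0 <= x i) ->
  (\sum_i p i * x i) ^+ a.+1 <= (\sum_i p i) ^+ a * \sum_i p i * x i ^+ a.+1.
Proof.
move=> p0 x0; elim: a => [|a IHa]; first by rewrite expr1 expr0 mul1r.
have S0 (f : I -> R) : (forall i, 0 <= f i) -> 0 <= \sum_i p i * f i.
  by move=> f0; apply: sumr_ge0 => i _; rewrite mulr_ge0.
rewrite exprSr; apply: le_trans (ler_wpM2r (S0 _ x0) IHa) _.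
rewrite exprSr -!mulrA ler_wpM2l ?exprn_ge0 ?sumr_ge0 //.
exact: chebyshev_sum.
Qed.

(** Think of [f] as [s] independent samples. Once the common value [c] of [f i] and [f j] is fixed,
    the weight is a product over positions, so the sum over [f] factors. *)
Lemma sum_ffun_collision (V : finType) (s : nat) (al : V -> R) (i j : 'I_s) :
  (forall a, 0 <= al a) -> \sum_a al a <= 1 -> i != j ->
  \sum_(f : {ffun 'I_s -> V}) (f i == f j)%:R * \prod_m al (f m)
    <= \sum_a al a ^+ 2.
Proof.
move=> al0 al1 ij.
pose F c m a := if (m == i) || (m == j) then (a == c)%:R * al a else al a.
have -> : \sum_(f : {ffun 'I_s -> V}) (f i == f j)%:R * \prod_m al (f m) =
    \sum_c \sum_(f : {ffun 'I_s -> V}) \prod_m F c m (f m).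
  rewrite exchange_big; apply: eq_bigr => f _.
  have prodE c : \prod_m F c m (f m) =
      (f i == c)%:R * (f j == c)%:R * \prod_m al (f m).
    rewrite (bigD1 i) //= (bigD1 j) 1?eq_sym //=.
    rewrite [in RHS](bigD1 i) //= [in RHS](bigD1 j) 1?eq_sym //=.
    rewrite (eq_bigr (fun m => al (f m))); last first.
      by move=> m /andP[mi mj]; rewrite /F (negPf mi) (negPf mj).
    by rewrite /F !eqxx orbT /=; ring.
  rewrite (eq_bigr _ (fun c _ => prodE c)) -mulr_suml; congr (_ * _).
  rewrite (bigD1 (f i)) //= eqxx mul1r eq_sym big1 ?addr0 // => c.
  by rewrite eq_sym => /negPf ->; rewrite mul0r.
apply: ler_sum => c _; rewrite -bigA_distr_bigA /=.
have Fc : \sum_a (a == c)%:R * al a = al c.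
  rewrite (bigD1 c) //= eqxx mul1r big1 ?addr0 // => a /negPf ->.
  by rewrite mul0r.
rewrite (bigD1 i) //= (bigD1 j) 1?eq_sym //= /F !eqxx orbT /= Fc.
rewrite mulrA expr2 ler_piMr ?mulr_ge0 //.
suff /andP[] : 0 <= \prod_(m | (m != i) && (m != j))
    \sum_a F c m a <= 1 by [].
rewrite /F; apply: (@big_ind _ (fun y => 0 <= y <= 1)) => [||m /andP[mi mj]].
- by rewrite lexx ler01.
- move=> y z /andP[y0 y1] /andP[z0 z1].
  by rewrite mulr_ge0 //= mulr_ile1.
by rewrite (negPf mi) (negPf mj) /= sumr_ge0.
Qed.

End Inequalities.

(** * A weighted Kovari-Sos-Turan inequality *)

Section WeightedKST.
Variables (R : rcfType) (V : finType) (A : rel V) (s : nat).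
Local Open Scope ring_scope.
Hypothesis few_common : forall f : {ffun 'I_s -> V}, injective f ->
  (#|[set b | [forall i, A (f i) b]]| <= s)%N.

(** By convexity the left side is at most the weight of the event that [s] independent samples from
    [al] are all adjacent to one sample from [be]. Either two of the [s] samples collide, or they
    are distinct and have at most [s] common neighbours, whose [be]-mass is at most [S] by
    Cauchy-Schwarz. *)
Lemma weighted_kst (al be : V -> R) : (0 < s)%N ->
  (forall a, 0 <= al a) -> (forall b, 0 <= be b) ->
  \sum_a al a <= 1 -> \sum_b be b <= 1 ->
  (\sum_a \sum_b (A a b)%:R * al a * be b) ^+ s <=
  (s ^ 2)%:R * (\sum_a al a ^+ 2) + Num.sqrt (s%:R * \sum_b be b ^+ 2).
Proof.
move=> s_gt0 al0 be0 al1 be1.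
set S : R := Num.sqrt _; have S0 : 0 <= S by apply: sqrtr_ge0.
pose X b := \sum_a (A a b)%:R * al a.
pose w (f : {ffun 'I_s -> V}) := \prod_m al (f m).
have w0 f : 0 <= w f by apply: prodr_ge0.
pose N (f : {ffun 'I_s -> V}) b : R := \prod_m (A (f m) b)%:R.
have NE f b : N f b = [forall m, A (f m) b]%:R.
  case: (boolP [forall m, A (f m) b]) => [/forallP AP|].
    by rewrite /N big1 // => m _; rewrite AP.
  rewrite negb_forall => /existsP[m /negPf Am].
  by rewrite /N (bigD1 m) //= Am mul0r.
pose Y f := \sum_b be b * N f b.
have X0 b : 0 <= X b by apply: sumr_ge0 => a _; rewrite mulr_ge0 ?ler0n.
have sum_w : \sum_f w f <= 1.
  rewrite /w -(bigA_distr_bigA (fun _ a => al a)) prodr_const.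
  by rewrite exprn_ile1 // sumr_ge0.
have Y1 f : Y f <= 1.
  apply: le_trans be1; apply: ler_sum => b _.
  by rewrite NE ler_piMr // lern1 leq_b1.
have YS (f : {ffun 'I_s -> V}) : injective f -> Y f <= S.
  move=> f_inj; apply: le_trans (ler_norm _) _; rewrite -sqrtr_sqr.
  rewrite ler_wsqrtr //; apply: le_trans (cauchy_schwarz _ _) _.
  rewrite mulrC ler_wpM2r ?sumr_ge0 // => [b _|]; first exact: sqr_ge0.
  have -> : \sum_b N f b ^+ 2 = #|[set b | [forall i, A (f i) b]]|%:R.
    rewrite -sum1_card natr_sum [RHS]big_mkcond /=; apply: eq_bigr => b _.
    by rewrite NE inE; case: ifP; rewrite ?expr1n ?expr0n.
  by rewrite ler_nat few_common.
have -> : \sum_a \sum_b (A a b)%:R * al a * be b = \sum_b be b * X b.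
  rewrite exchange_big; apply: eq_bigr => b _.
  by rewrite mulr_sumr; apply: eq_bigr => a _; rewrite mulrC.
have XE b : X b ^+ s = \sum_f N f b * w f.
  rewrite -{1}(card_ord s) -prodr_const bigA_distr_bigA /=.
  by apply: eq_bigr => f _; rewrite big_split.
apply: (@le_trans _ _ (\sum_b be b * X b ^+ s)).
  rewrite -(prednK s_gt0); apply: le_trans (power_mean _ be0 X0) _.
  rewrite ler_piMl ?exprn_ile1 ?sumr_ge0 // => b _.
  by rewrite mulr_ge0 // exprn_ge0.
have -> : \sum_b be b * X b ^+ s = \sum_f w f * Y f.
  rewrite (eq_bigr _ (fun b _ => congr1 _ (XE b))).
  under eq_bigr => b _ do rewrite mulr_sumr.
  rewrite exchange_big; apply: eq_bigr => f _.
  by rewrite mulr_sumr; apply: eq_bigr => b _; ring.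
(* A non-injective [f] is charged to a colliding pair, using [Y f <= 1]; an injective one has
   [Y f <= S]. *)
apply: (@le_trans _ _ (\sum_(f : {ffun 'I_s -> V})
    (\sum_(p : 'I_s * 'I_s | p.1 != p.2)
    (f p.1 == f p.2)%:R * w f + w f * S))).
  apply: ler_sum => f _; have [f_inj|] := boolP (injectiveb f).
    rewrite -[leLHS]add0r lerD ?ler_wpM2l ?sumr_ge0 // => [p _|].
      by rewrite mulr_ge0 ?ler0n.
    exact/YS/injectiveP.
  case/injectivePn => i [j ij fij].
  rewrite -[leLHS]addr0 lerD ?mulr_ge0 // (bigD1 (i, j)) //= fij eqxx mul1r.
  rewrite -[leLHS]addr0 lerD ?ler_piMr ?sumr_ge0 // => p _.
  by rewrite mulr_ge0 ?ler0n.
rewrite big_split /= lerD //; last by rewrite -mulr_suml ler_piMl.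
rewrite exchange_big /=.
apply: (@le_trans _ _ (\sum_(p : 'I_s * 'I_s) \sum_a al a ^+ 2)).
  rewrite big_mkcond /=; apply: ler_sum => p _; case: ifP => [p12|_].
    exact: sum_ffun_collision.
  by rewrite sumr_ge0 // => a _; apply: sqr_ge0.
by rewrite sumr_const card_prod card_ord mulnn mulr_natl.
Qed.

End WeightedKST.

(** * Weighted walks of a symmetric nonnegative matrix *)

Section Walks.
Variables (R : rcfType) (V : finType) (M : V -> V -> R).
Local Open Scope ring_scope.

Fixpoint walk (m : nat) (x y : V) : R :=
  if m is m'.+1 then \sum_z M x z * walk m' z y else (x == y)%:R.

(** Unlike [walk], this integrates a function of the whole trajectory; the list given to [F] omits
    the starting vertex. *)
Fixpoint walk_sum (m : nat) (x : V) (F : seq V -> R) : R :=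
  if m is m'.+1 then \sum_y M x y * walk_sum m' y (fun t => F (y :: t))
  else F [::].

(** The quantity [h_m]; for symmetric [M] it is the total weight of closed walks of length
    [2 * m]. *)
Definition walk_norm (m : nat) : R := \sum_x \sum_y walk m x y ^+ 2.

(** Total weight of the closed walks of length [i + j] whose vertices at positions 0 and [i]
    coincide. *)
Definition coincide (i j : nat) : R := \sum_a walk i a a * walk j a a.

Lemma sum_delta (f : V -> R) x : \sum_y (x == y)%:R * f y = f x.
Proof.
rewrite (bigD1 x) //= eqxx mul1r big1 ?addr0 // => y.
by rewrite eq_sym => /negPf ->; rewrite mul0r.
Qed.

Lemma walkD i j x y : walk (i + j) x y = \sum_z walk i x z * walk j z y.
Proof.
elim: i x => [|i IHi] x /=; first by rewrite sum_delta.
under eq_bigr => z _ do rewrite IHi mulr_sumr.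
rewrite exchange_big; apply: eq_bigr => z _.
by rewrite mulr_suml; apply: eq_bigr => t _; rewrite mulrA.
Qed.

Lemma walk1 x y : walk 1 x y = M x y.
Proof.
rewrite /=; under eq_bigr => z _ do rewrite mulrC eq_sym.
by rewrite sum_delta.
Qed.

Lemma eq_walk_sum m x F G : (forall t, size t = m -> F t = G t) ->
  walk_sum m x F = walk_sum m x G.
Proof.
elim: m x F G => [|m IHm] x F G FG /=; first exact: FG.
apply: eq_bigr => y _; congr (_ * _); apply: IHm => t st.
by apply: FG; rewrite /= st.
Qed.

Lemma walk_sumD m n x F :
  walk_sum (m + n) x F =
  walk_sum m x (fun t => walk_sum n (last x t) (fun t' => F (t ++ t'))).
Proof.
by elim: m x F => //= m IHm x F; apply: eq_bigr => y _; rewrite IHm.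
Qed.

Lemma walk_sum_last m x g :
  walk_sum m x (fun t => g (last x t)) = \sum_y walk m x y * g y.
Proof.
elim: m x => [|m IHm] x /=; first by rewrite sum_delta.
under eq_bigr => y _ do rewrite IHm mulr_sumr.
rewrite exchange_big; apply: eq_bigr => y _.
by rewrite mulr_suml; apply: eq_bigr => z _; rewrite mulrA.
Qed.

Lemma walk_sumB m x F G :
  walk_sum m x (fun t => F t - G t) = walk_sum m x F - walk_sum m x G.
Proof.
elim: m x F G => //= m IHm x F G.
by rewrite -sumrB; apply: eq_bigr => y _; rewrite IHm mulrBr.
Qed.

Lemma walk_sum_big (I : finType) (P : pred I) m x (F : I -> seq V -> R) :
  walk_sum m x (fun t => \sum_(i | P i) F i t) =
  \sum_(i | P i) walk_sum m x (F i).
Proof.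
elim: m x F => //= m IHm x F; rewrite exchange_big; apply: eq_bigr => y _.
by rewrite IHm mulr_sumr.
Qed.

Hypothesis M_ge0 : forall x y, 0 <= M x y.
Hypothesis M_sym : forall x y, M x y = M y x.

Lemma walk_ge0 m x y : 0 <= walk m x y.
Proof.
elim: m x => [|m IHm] x /=; first exact: ler0n.
by apply: sumr_ge0 => z _; rewrite mulr_ge0.
Qed.

Lemma walk_sym m x y : walk m x y = walk m y x.
Proof.
elim: m x y => [|m IHm] x y; first by rewrite /= eq_sym.
rewrite -[in RHS]addn1 walkD /=; apply: eq_bigr => z _.
by rewrite -/(walk 1 z x) walk1 mulrC IHm M_sym.
Qed.

Lemma walk_norm_trace j : walk_norm j = \sum_x walk (j + j) x x.
Proof.
apply: eq_bigr => x _; rewrite walkD; apply: eq_bigr => y _.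
by rewrite expr2 (walk_sym j y x).
Qed.

(** First-moment principle: a positive sum has a positive term. [F] itself may take negative
    values. *)
Lemma walk_sum_gt0 m x F : 0 < walk_sum m x F ->
  exists t, [/\ size t = m, path (fun a b => 0 < M a b) x t & 0 < F t].
Proof.
elim: m x F => [|m IHm] x F /=; first by exists [::].
move=> F0; have [y Fy] : exists y, 0 < M x y * walk_sum m y (fun t => F (y :: t)).
  apply/existsP; apply: contraLR F0 => /existsPn Fy.
  by rewrite -leNgt sumr_le0 // => y _; rewrite leNgt Fy.
have Mxy : 0 < M x y.
  rewrite lt_neqAle M_ge0 andbT; apply: contraTneq Fy => <-.
  by rewrite mul0r ltxx.
move: Fy; rewrite pmulr_rgt0 // => /IHm[t [<- pt Ft]].
by exists (y :: t); rewrite /= Mxy.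
Qed.

(** For symmetric [M], [walk_norm j.+1] is also the inner product of the powers [j] and [j.+2] of
    [M]. *)
Lemma walk_norm_logconvex j :
  walk_norm j.+1 ^+ 2 <= walk_norm j * walk_norm j.+2.
Proof.
have E : walk_norm j.+1 = \sum_p walk j p.1 p.2 * walk j.+2 p.1 p.2.
  rewrite walk_norm_trace addSnnS -(pair_bigA _ (fun x y => _ x y * _ x y)) /=.
  apply: eq_bigr => x _; rewrite walkD; apply: eq_bigr => y _.
  by rewrite (walk_sym j.+2).
rewrite E /walk_norm !(pair_bigA _ (fun x y => walk _ x y ^+ 2)).
exact: cauchy_schwarz.
Qed.

(** Every power of [M] fixes [v]; Cauchy-Schwarz in each row, summed over the rows, bounds the
    squared norm of [v] by [walk_norm m] times itself. *)
Lemma walk_norm_ge1 (v : V -> R) m :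
  (forall x, \sum_y M x y * v y = v x) -> 0 < \sum_x v x ^+ 2 ->
  1 <= walk_norm m.
Proof.
move=> Mv v_gt0.
have Wv x : \sum_y walk m x y * v y = v x.
  rewrite -walk_sum_last; elim: m x => //= m IHm x.
  by rewrite -[RHS]Mv; apply: eq_bigr => y _; rewrite IHm.
rewrite -(ler_pM2r v_gt0) mul1r mulr_suml; apply: ler_sum => x _.
by rewrite -{1}(Wv x) cauchy_schwarz.
Qed.

(** By log-convexity the ratios [walk_norm j / walk_norm j.+1] do not increase with [j], so the last
    one is at most each factor of the telescoping product from 0 to [k.+1]. *)
Lemma walk_norm_ratio k : (forall j, 0 < walk_norm j) ->
  (walk_norm k / walk_norm k.+1) ^+ k.+1 * walk_norm k.+1 <= walk_norm 0.
Proof.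
move=> h0; set r := walk_norm k / _.
have r0 : 0 <= r by rewrite divr_ge0 // ltW.
have rat j d : walk_norm (j + d) / walk_norm (j + d).+1 <=
    walk_norm j / walk_norm j.+1.
  elim: d => [|d IHd]; first by rewrite addn0.
  apply: le_trans IHd; rewrite addnS.
  rewrite ler_pdivrMr // mulrAC ler_pdivlMr // -expr2.
  exact: walk_norm_logconvex.
suff H m : (m <= k.+1)%N -> r ^+ m * walk_norm m <= walk_norm 0 by apply: H.
elim: m => [|m IHm] lt_mk; first by rewrite expr0 mul1r.
apply: le_trans (IHm (ltnW lt_mk)); rewrite exprSr -mulrA ler_wpM2l ?exprn_ge0 //.
rewrite -ler_pdivlMr // /r; have := rat m (k - m)%N.
by rewrite subnKC.
Qed.

(* With [y] the neighbour of [a] on the arc of length [i.+1] and [z] antipodal to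
   [y], one half of the closed walk goes from [y] to [z] through [a]; the other
   half is the edge from [y] back to [a] followed by [k] steps to [z]. The
   Cauchy-Schwarz inequality separates the two halves. *)
Lemma coincide_le c k i : (forall a, \sum_y M a y ^+ 2 <= c) -> (i <= k)%N ->
  coincide i.+1 (k.+1 - i + k) ^+ 2 <= walk_norm k.+1 * (c * walk_norm k).
Proof.
move=> Mc le_ik.
pose T a y z := walk i y a * walk (k.+1 - i) a z.
have T0 a y z : 0 <= T a y z by rewrite mulr_ge0 ?walk_ge0.
have sumT y z : \sum_a T a y z = walk k.+1 y z by rewrite -walkD subnKC // ltnW.
have T_le a y z : T a y z <= walk k.+1 y z.
  by rewrite -sumT (bigD1 a) //= lerDl sumr_ge0.
have -> : coincide i.+1 (k.+1 - i + k) =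
    \sum_(q : V * (V * V)) T q.1 q.2.1 q.2.2 * (M q.1 q.2.1 * walk k q.1 q.2.2).
  rewrite -(pair_bigA _ (fun a q => T a q.1 q.2 * (M a q.1 * walk k a q.2))) /=.
  apply: eq_bigr => a _.
  rewrite -(pair_bigA _ (fun y z => T a y z * (M a y * walk k a z))) /=.
  rewrite walkD mulr_suml; apply: eq_bigr => y _; rewrite mulr_sumr.
  by apply: eq_bigr => z _; rewrite (walk_sym k z) /T; ring.
(* Replacing one factor of [T ^+ 2] by [walk k.+1 y z] lets the sum over [a] of the other collapse,
   leaving [walk_norm k.+1]. *)
apply: le_trans (cauchy_schwarz_dom
  (a := fun q => T q.1 q.2.1 q.2.2 * walk k.+1 q.2.1 q.2.2) _ _) _ => [q|].
  by rewrite expr2 ler_wpM2l.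
rewrite ler_pM ?sumr_ge0 //.
- by move=> q _; rewrite mulr_ge0 ?walk_ge0.
- by move=> q _; apply: sqr_ge0.
- rewrite -(pair_bigA _ (fun a q => T a q.1 q.2 * walk k.+1 q.1 q.2)) /=.
  rewrite exchange_big /walk_norm (pair_bigA _ (fun x y => walk k.+1 x y ^+ 2)).
  apply: ler_sum => q _ /=.
  by rewrite -mulr_suml sumT expr2.
rewrite -(pair_bigA _ (fun a q => (M a q.1 * walk k a q.2) ^+ 2)) /=.
rewrite mulr_sumr; apply: ler_sum => a _.
rewrite -(pair_bigA _ (fun y z => (M a y * walk k a z) ^+ 2)) /=.
rewrite (eq_bigr (fun y => \sum_z M a y ^+ 2 * walk k a z ^+ 2)).
  by rewrite -big_distrlr ler_wpM2r ?sumr_ge0 // => z _; apply: sqr_ge0.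
by move=> y _; apply: eq_bigr => z _; rewrite exprMn.
Qed.

End Walks.

(** * Chords of closed walks *)

Section ClosedWalks.
Variables (R : rcfType) (V : finType) (M : V -> V -> R).
Local Open Scope ring_scope.
Local Notation walk := (walk M).
Local Notation walk_norm := (walk_norm M).
Local Notation coincide := (coincide M).
Local Notation walk_sum := (walk_sum M).
Hypothesis M_ge0 : forall x y, 0 <= M x y.
Hypothesis M_sym : forall x y, M x y = M y x.

(** For symmetric [M], the weight of closed walks of length [i + j] with [A] between positions 0 and
    [i]; taking equality for [A] gives [coincide]. *)
Definition chord (A : rel V) (i j : nat) : R :=
  \sum_a \sum_b (A a b)%:R * (walk i a b * walk j a b).

(** Cut the closed walk at positions [i] and [j]: the piece after [j] and the piece before [i] join
    at [a] into one arc. *)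
Lemma closed_walk_pair m i j (A : rel V) : (i <= j <= m)%N ->
  \sum_a walk_sum m a (fun t =>
    (a == last a t)%:R * (A (nth a (a :: t) i) (nth a (a :: t) j))%:R) =
  chord A (j - i) (m - (j - i)).
Proof.
case/andP=> ij jm.
pose F a b c : R := walk (m - j) c a * (A b c)%:R.
have step a : walk_sum m a (fun t =>
    (a == last a t)%:R * (A (nth a (a :: t) i) (nth a (a :: t) j))%:R) =
    \sum_b walk i a b * \sum_c walk (j - i) b c * F a b c.
  have {1}-> : m = (i + ((j - i) + (m - j)))%N by lia.
  rewrite walk_sumD -walk_sum_last.
  apply: eq_walk_sum => t st; rewrite walk_sumD -walk_sum_last.
  apply: eq_walk_sum => t' st'.
  rewrite (@eq_walk_sum _ _ _ _ _ _ (fun t'' =>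
      (a == last (last (last a t) t') t'')%:R *
      (A (last a t) (last (last a t) t'))%:R)).
    rewrite (walk_sum_last _ _ _ (fun d => (a == d)%:R * _)).
    rewrite (eq_bigr (fun d => (a == d)%:R * (walk (m - j) (last (last a t) t') d
      * (A (last a t) (last (last a t) t'))%:R))) ?sum_delta //.
    by move=> d _; ring.
  move=> t'' _; rewrite !last_cat; congr (_ * (A _ _)%:R).
    by rewrite -cat_cons nth_cat /= st ltnS leqnn -st -last_nth.
  rewrite catA -cat_cons nth_cat /= size_cat st st' subnKC // ltnS leqnn.
  by rewrite -last_cat -[j in LHS](subnKC ij) -{1}st -{1}st' -size_cat -last_nth.
rewrite (eq_bigr _ (fun a _ => step a)) exchange_big /=.
apply: eq_bigr => b _.
transitivity (\sum_a \sum_c (A b c)%:R * (walk (j - i) b c *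
    (walk (m - j) c a * walk i a b))).
  apply: eq_bigr => a _; rewrite mulr_sumr; apply: eq_bigr => c _.
  by rewrite /F; ring.
rewrite exchange_big; apply: eq_bigr => c _.
rewrite -!mulr_sumr -walkD (walk_sym M_sym (m - _) b c).
have -> : (m - (j - i) = (m - j) + i)%N by lia.
by [].
Qed.

(* Take [u] adjacent to [a] on the arc of length [i.+1] and [v] antipodal to [u].
   Given [u] and [v] the two halves of the closed walk are independent, [a] lies
   on one and [b] on the other, and the probability that two samples of the same
   half have the same vertex in the place of [a] (or [b]) is a [coincide]. *)
Lemma chord_le (A : rel V) s k i : (0 < s)%N ->
  (forall f : {ffun 'I_s -> V}, injective f ->
     (#|[set b | [forall m, A (f m) b]]| <= s)%N) ->
  0 < walk_norm k.+1 -> (i <= k)%N ->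
  (chord A i.+1 (k.+1 - i + k) / walk_norm k.+1) ^+ s <=
  (s ^ 2)%:R * (coincide 2 (k + k) / walk_norm k.+1) +
  Num.sqrt (s%:R *
    (coincide (i + i) ((k.+1 - i) + (k.+1 - i)) / walk_norm k.+1)).
Proof.
move=> s_gt0 fewA h_gt0 le_ik; set h := walk_norm k.+1 in h_gt0 *.
pose w u v := walk k.+1 u v.
pose al0 u v a := M u a * walk k a v.
pose be0 u v b := walk i u b * walk (k.+1 - i) b v.
have al0_ge0 u v a : 0 <= al0 u v a by rewrite mulr_ge0 ?walk_ge0.
have be0_ge0 u v b : 0 <= be0 u v b by rewrite mulr_ge0 ?walk_ge0.
have sum_al0 u v : \sum_a al0 u v a = w u v by [].
have sum_be0 u v : \sum_b be0 u v b = w u v.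
  by rewrite /w -[in RHS](subnKC (leqW le_ik)) walkD.
have w_ge0 u v : 0 <= w u v by apply: walk_ge0.
(* If [w u v] is 0, the quotient is 0 by convention, but then [f a] is 0 as well. *)
have scale (f : V -> R) u v a : (forall a, 0 <= f a) -> \sum_a f a = w u v ->
    w u v * (f a / w u v) = f a.
  move=> f0 fw; have [w0|w_neq0] := eqVneq (w u v) 0; last by rewrite mulrC divfK.
  have: f a <= \sum_a f a by rewrite (bigD1 a) //= lerDl sumr_ge0.
  by rewrite fw w0 mul0r => fa; apply/eqP; rewrite eq_le f0 fa.
have mass1 (f : V -> R) u v : (forall a, 0 <= f a) -> \sum_a f a = w u v ->
    \sum_a f a / w u v <= 1.
  move=> f0 fw; rewrite -mulr_suml fw.
  by have [->|w_neq0] := eqVneq (w u v) 0; rewrite ?mul0r ?ler01 // divff.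
pose al u v a := al0 u v a / w u v.
pose be u v b := be0 u v b / w u v.
have al_ge0 u v a : 0 <= al u v a by rewrite divr_ge0.
have be_ge0 u v b : 0 <= be u v b by rewrite divr_ge0.
pose rho u v := \sum_a \sum_b (A a b)%:R * al u v a * be u v b.
have rho_ge0 u v : 0 <= rho u v.
  apply: sumr_ge0 => a _; apply: sumr_ge0 => b _.
  by apply: mulr_ge0 => //; apply: mulr_ge0 => //; apply: ler0n.
have chordE : chord A i.+1 (k.+1 - i + k) = \sum_u \sum_v w u v ^+ 2 * rho u v.
  transitivity (\sum_a \sum_b \sum_u \sum_v
      (A a b)%:R * (al0 u v a * be0 u v b)).
    apply: eq_bigr => a _; apply: eq_bigr => b _.
    rewrite (walk_sym M_sym (_ + _) a b) walkD /=.
    rewrite big_distrlr mulr_sumr; apply: eq_bigr => u _ /=.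
    rewrite mulr_sumr; apply: eq_bigr => v _.
    by rewrite /al0 /be0 (M_sym u a) (walk_sym M_sym k v a); ring.
  under eq_bigr => a _ do rewrite exchange_big.
  rewrite exchange_big; apply: eq_bigr => u _ /=.
  under eq_bigr => a _ do rewrite exchange_big.
  rewrite exchange_big; apply: eq_bigr => v _ /=.
  rewrite mulr_sumr; apply: eq_bigr => a _.
  rewrite mulr_sumr; apply: eq_bigr => b _.
  rewrite -(scale (al0 u v) u v a) // -(scale (be0 u v) u v b) //.
  by rewrite /al /be; ring.
(* The law of an antipodal pair on a random closed walk of length [2 * k.+1]. *)
pose p (q : V * V) := w q.1 q.2 ^+ 2 / h.
have p_ge0 q : 0 <= p q by rewrite divr_ge0 ?sqr_ge0 // ltW.
have sum_p : \sum_q p q = 1.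
  rewrite -mulr_suml -(pair_bigA _ (fun u v => w u v ^+ 2)) /= divff //.
  exact: lt0r_neq0.
have jensen x m : (0 < m)%N -> (forall q, 0 <= x q) ->
    (\sum_q p q * x q) ^+ m <= \sum_q p q * x q ^+ m.
  case: m => // m _ x0; apply: le_trans (power_mean _ p_ge0 x0) _.
  by rewrite sum_p expr1n mul1r.
(* The factor [w ^+ 2] in [p] cancels the squared normalisation of [f0]. *)
have sqmass (f0 : V -> V -> V -> R) : (forall u v a, 0 <= f0 u v a) ->
    (forall u v, \sum_a f0 u v a = w u v) ->
    \sum_q p q * \sum_a (f0 q.1 q.2 a / w q.1 q.2) ^+ 2 =
    (\sum_u \sum_v \sum_a f0 u v a ^+ 2) / h.
  move=> f00 f0w; rewrite (pair_bigA _ (fun u v => \sum_a f0 u v a ^+ 2)) mulr_suml.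
  apply: eq_bigr => -[u v] _ /=; rewrite mulr_sumr mulr_suml.
  apply: eq_bigr => a _; rewrite -[in RHS](scale (f0 u v) u v a) //.
  by rewrite /p /=; ring.
have -> : chord A i.+1 (k.+1 - i + k) / h = \sum_q p q * rho q.1 q.2.
  rewrite chordE (pair_bigA _ (fun u v => w u v ^+ 2 * rho u v)) mulr_suml.
  by apply: eq_bigr => q _; rewrite /p /=; ring.
apply: le_trans (jensen (fun q => rho q.1 q.2) _ s_gt0 _) _ => [q|]; first exact: rho_ge0.
pose S (q : V * V) := Num.sqrt (s%:R * \sum_b be q.1 q.2 b ^+ 2).
apply: (@le_trans _ _ (\sum_q p q *
    ((s ^ 2)%:R * (\sum_a al q.1 q.2 a ^+ 2) + S q))).
  apply: ler_sum => q _; rewrite ler_wpM2l //.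
  by apply: weighted_kst; rewrite ?mass1.
under eq_bigr => q _ do rewrite mulrDr mulrCA.
(* For fixed [a], [al0 u v a ^+ 2] summed over [u] and [v] splits into closed walks at [a] of
   lengths 2 and [k + k]; [be0] is treated alike below. *)
rewrite big_split -mulr_sumr /= lerD //.
  rewrite sqmass // ler_wpM2l ?ler0n // ler_wpM2r ?invr_ge0 ?(ltW h_gt0) //.
  rewrite /coincide; under eq_bigr => u _ do rewrite exchange_big.
  rewrite exchange_big; apply: ler_sum => a _.
  rewrite -[2%N]addn1 !walkD big_distrlr; apply: ler_sum => u _.
  apply: ler_sum => v _; rewrite !walk1 /al0 (M_sym u a) (walk_sym M_sym k v a).
  by rewrite exprMn !expr2.
have S_ge0 q : 0 <= S q by apply: sqrtr_ge0.
(* Jensen for squaring moves the average over [q] under the square root. *)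
rewrite -[leLHS]ger0_norm; last by apply: sumr_ge0 => q _; rewrite mulr_ge0.
rewrite -sqrtr_sqr ler_wsqrtr //; apply: le_trans (jensen S 2%N _ S_ge0) _ => //.
under eq_bigr => q _.
  rewrite sqr_sqrtr; last by rewrite mulr_ge0 ?ler0n ?sumr_ge0 // => b _; apply: sqr_ge0.
  rewrite mulrCA; over.
rewrite -mulr_sumr sqmass // ler_wpM2l ?ler0n // ler_wpM2r ?invr_ge0 ?(ltW h_gt0) //.
rewrite /coincide; under eq_bigr => u _ do rewrite exchange_big.
rewrite exchange_big; apply: ler_sum => b _ /=.
rewrite !walkD big_distrlr; apply: ler_sum => u _.
apply: ler_sum => v _; rewrite /be0 (walk_sym M_sym i b u).
by rewrite (walk_sym M_sym _ v b) exprMn !expr2.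
Qed.

End ClosedWalks.

(* There are [N = (2k)^2] pairs of positions on the cycle, so each bad event should
   have probability below [1 / 2N]. If coincidences have probability below
   [threshold^-2], then [chord_le] bounds the [s]-th power of the probability of a
   chord by [(s^2 + s) / threshold = (2N)^-s]. *)
Definition threshold (k s : nat) : nat := (2 * (2 * k) ^ 2) ^ s * (s ^ 2 + s).

Lemma threshold_gt0 k s : 0 < k -> 0 < s -> 0 < threshold k s.
Proof.
move=> k_gt0 s_gt0; rewrite muln_gt0 addn_gt0 s_gt0 orbT andbT.
by rewrite expn_gt0 !muln_gt0 k_gt0.
Qed.

(** * Induced closed walks in graphs of large minimum degree *)

Section InducedClosedWalk.
Variables (R : rcfType) (V : finType) (e : rel V) (d : nat).
Local Open Scope ring_scope.
Hypothesis e_sym : symmetric e.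
Hypothesis d_gt0 : (0 < d)%N.
Hypothesis min_deg : forall x, (d <= #|e x|)%N.

Let sdeg x : R := Num.sqrt (#|e x|%:R).

(* The symmetrized transition matrix of the simple random walk: the closed walk
   [x_1, ..., x_m] has weight [1 / (deg x_1 * ... * deg x_m)]. *)
Definition kernel (x y : V) : R := (e x y)%:R / (sdeg x * sdeg y).

Local Notation walk_norm := (walk_norm kernel).
Local Notation coincide := (coincide kernel).
Local Notation chord := (chord kernel).

Lemma deg_gt0 x : 0 < #|e x|%:R :> R.
Proof. by rewrite ltr0n (leq_trans d_gt0). Qed.

Lemma sdeg_gt0 x : 0 < sdeg x.
Proof. by rewrite sqrtr_gt0 deg_gt0. Qed.

Lemma sqr_sdeg x : sdeg x ^+ 2 = #|e x|%:R.
Proof. by rewrite sqr_sqrtr // ltW ?deg_gt0. Qed.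

Lemma sum_adj x : \sum_y (e x y)%:R = #|e x|%:R :> R.
Proof.
rewrite -sum1_card natr_sum [RHS]big_mkcond /=; apply: eq_bigr => y _.
by rewrite unfold_in; case: ifP.
Qed.

Lemma kernel_ge0 x y : 0 <= kernel x y.
Proof. by rewrite divr_ge0 ?ler0n // mulr_ge0 // ltW ?sdeg_gt0. Qed.

Lemma kernel_sym x y : kernel x y = kernel y x.
Proof. by rewrite /kernel e_sym mulrC [_ * sdeg x]mulrC mulrC. Qed.

Lemma kernel_gt0 x y : 0 < kernel x y -> e x y.
Proof. by rewrite /kernel; case: (e x y) => //; rewrite mul0r ltxx. Qed.

(** Each neighbour [y] contributes [1 / (deg x * deg y)], at most [1 / (deg x * d)]. This is the
    constant [c] of [coincide_le]. *)
Lemma sum_sqr_kernel x : \sum_y kernel x y ^+ 2 <= d%:R^-1.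
Proof.
apply: (@le_trans _ _ (\sum_y (e x y)%:R * (#|e x|%:R * d%:R)^-1)).
  apply: ler_sum => y _; rewrite /kernel expr_div_n exprMn !sqr_sdeg.
  case: (e x y); last by rewrite expr0n /= !mul0r.
  rewrite expr1n !mul1r lef_pV2 ?posrE ?mulr_gt0 ?deg_gt0 ?ltr0n //.
  by rewrite ler_pM2l ?deg_gt0 // ler_nat min_deg.
rewrite -mulr_suml sum_adj invfM mulrA divff ?mul1r //.
exact: lt0r_neq0 (deg_gt0 x).
Qed.

Lemma kernel_eigenvector x : \sum_y kernel x y * sdeg y = sdeg x.
Proof.
transitivity (\sum_y (e x y)%:R / sdeg x).
  apply: eq_bigr => y _; rewrite /kernel invfM -!mulrA mulVf ?mulr1 //.
  exact: lt0r_neq0 (sdeg_gt0 y).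
rewrite -mulr_suml sum_adj -sqr_sdeg expr2 mulfK //.
exact: lt0r_neq0 (sdeg_gt0 x).
Qed.

Hypothesis V_gt0 : (0 < #|V|)%N.

Lemma kernel_norm_ge1 m : 1 <= walk_norm m.
Proof.
apply: (walk_norm_ge1 (v := sdeg)) kernel_eigenvector _.
case/card_gt0P: V_gt0 => x _.
rewrite (bigD1 x) //= ltr_pwDl ?exprn_gt0 ?sdeg_gt0 //.
by apply: sumr_ge0 => y _; apply: sqr_ge0.
Qed.

Lemma kernel_norm_gt0 m : 0 < walk_norm m.
Proof. exact: lt_le_trans ltr01 (kernel_norm_ge1 m). Qed.

Lemma walk_norm0 : walk_norm 0 = #|V|%:R.
Proof.
rewrite -sum1_card natr_sum; apply: eq_bigr => x _ /=.
under eq_bigr => y _ do rewrite expr2.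
by rewrite sum_delta eqxx.
Qed.

Section Sparse.
Variables (k s : nat).
Let K := k.+1.
Let N := ((2 * K) ^ 2)%N.
Hypothesis s_gt0 : (0 < s)%N.
Hypothesis d_large : (threshold K s ^ (4 * K) * #|V| < d ^ K)%N.
Let P : R := (threshold K s)%:R^-1.

Lemma threshold_inv_gt0 : 0 < P.
Proof. by rewrite invr_gt0 ltr0n threshold_gt0. Qed.

Lemma threshold_inv_le : P <= ((2 * N)%:R)^-1.
Proof.
rewrite lef_pV2 ?posrE ?ltr0n ?threshold_gt0 ?muln_gt0 //.
rewrite ler_nat /threshold -/N -[leqLHS]muln1 leq_mul ?addn_gt0 ?s_gt0 ?orbT //.
by rewrite -{1}[(2 * N)%N]expn1 leq_pexp2l.
Qed.

Lemma threshold_inv_le1 : P <= 1.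
Proof.
apply: le_trans threshold_inv_le _.
by rewrite invf_le1 ?ltr0n ?ler1n ?muln_gt0.
Qed.

(** Here [q ^+ 2 <= r / d] and [r ^+ K <= #|V|], so [P ^+ 2 <= q] would give
    [P ^+ (4 * K) <= #|V| / d ^+ K], against [d_large]. *)
Lemma coincide_small_half l : (l <= k)%N ->
  coincide l.+1 (K - l + k) / walk_norm K < P ^+ 2.
Proof.
move=> lk; set h := walk_norm K; set r := walk_norm k / h.
have h0 : 0 < h by apply: kernel_norm_gt0.
have r0 : 0 <= r by rewrite divr_ge0 // ltW // kernel_norm_gt0.
have d0 : 0 < d%:R :> R by rewrite ltr0n.
set q := _ / h.
have q0 : 0 <= q.
  rewrite divr_ge0 ?(ltW h0) // sumr_ge0 // => a _.
  by rewrite mulr_ge0 ?walk_ge0 //; apply: kernel_ge0.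
have q2 : q ^+ 2 <= r / d%:R.
  rewrite expr_div_n ler_pdivrMr ?exprn_gt0 //.
  apply: le_trans (coincide_le kernel_ge0 kernel_sym sum_sqr_kernel lk) _.
  rewrite -/h le_eqVlt; apply/orP; left; apply/eqP.
  rewrite /r; field.
  by rewrite !lt0r_neq0.
have rK : r ^+ K <= #|V|%:R.
  have := walk_norm_ratio kernel_sym k kernel_norm_gt0.
  rewrite -/h -/r walk_norm0; apply: le_trans.
  by apply: ler_peMr; [apply: exprn_ge0|apply: kernel_norm_ge1].
rewrite ltNge; apply/negP => Pq.
have : P ^+ (4 * K) <= #|V|%:R / d%:R ^+ K.
  apply: (@le_trans _ _ ((q ^+ 2) ^+ K)).
    rewrite -exprM (_ : 4 * K = 2 * (2 * K))%N; last by rewrite mulnA.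
    by rewrite exprM lerXn2r // nnegrE exprn_ge0 // ltW ?threshold_inv_gt0.
  apply: (@le_trans _ _ ((r / d%:R) ^+ K)).
    by apply: lerXn2r q2; rewrite nnegrE ?sqr_ge0 // divr_ge0 // ltW.
  by rewrite expr_div_n ler_wpM2r // invr_ge0 exprn_ge0 // ltW.
rewrite /P exprVn ler_pdivlMr ?exprn_gt0 // mulrC ler_pdivrMr; last first.
  by rewrite exprn_gt0 // ltr0n threshold_gt0.
by rewrite -!natrX -natrM ler_nat leqNgt mulnC d_large.
Qed.

Lemma coincide_small l : (0 < l < 2 * K)%N ->
  coincide l (2 * K - l) / walk_norm K < P ^+ 2.
Proof.
move=> /andP[l0 l2].
wlog lK : l l0 l2 / (l <= K)%N => [H|].
  case: (leqP l K) => [|lK]; first exact: H.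
  have := H (2 * K - l)%N; rewrite subKn ?(ltnW l2) //.
  rewrite /coincide; under eq_bigr => a _ do rewrite mulrC.
  by apply; lia.
have -> : (2 * K - l = K - l.-1 + k)%N by rewrite /K; lia.
by rewrite -{1}(prednK l0); apply: coincide_small_half; rewrite /K in lK *; lia.
Qed.

Hypothesis few_common : forall f : {ffun 'I_s -> V}, injective f ->
  (#|[set b | [forall m, e (f m) b]]| <= s)%N.

(** After exchanging the arcs so that [l <= K], [chord_le] applies with [i = l - 1]. Its
    coincidences sit at distances 2 and [2 * (l - 1)], both strictly between 0 and [2 * K], so
    [coincide_small] bounds its two terms by [s ^ 2 * P] and [s * P]. *)
Lemma chord_small l : (1 < l < 2 * K - 1)%N ->
  chord e l (2 * K - l) / walk_norm K < ((2 * N)%:R)^-1.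
Proof.
move=> /andP[l1 l2]; have h0 := kernel_norm_gt0 K.
wlog lK : l l1 l2 / (l <= K)%N => [H|].
  case: (leqP l K) => [|lK]; first exact: H.
  have := H (2 * K - l)%N; rewrite subKn; last by lia.
  rewrite /chord; under eq_bigr => a _ do under eq_bigr => b _ do
    rewrite [X in _ * X]mulrC.
  by apply; lia.
have -> : (2 * K - l = K - l.-1 + k)%N by rewrite /K; lia.
have lk : (l.-1 <= k)%N by rewrite /K in lK *; lia.
have := chord_le kernel_ge0 kernel_sym s_gt0 few_common h0 lk.
rewrite prednK ?(ltnW l1) //; set q := _ / _ => qs.
have PP : 0 < P := threshold_inv_gt0.
have P2 : P ^+ 2 <= P by rewrite expr2 ler_piMr ?(ltW PP) // threshold_inv_le1.
rewrite ltNge; apply/negP => Nq.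
have {}Nq : ((2 * N)%:R)^-1 ^+ s <= q ^+ s.
  by rewrite lerXn2r ?nnegrE ?invr_ge0 ?ler0n // (le_trans _ Nq) ?invr_ge0 ?ler0n.
have : q ^+ s < (s ^ 2 + s)%:R * P.
  apply: le_lt_trans qs _; rewrite natrD mulrDl ltr_leD //.
    rewrite ltr_pM2l ?ltr0n ?expn_gt0 ?s_gt0 //.
    apply: lt_le_trans P2; have := @coincide_small 2.
    by rewrite (_ : (2 * K - 2)%N = (k + k)%N); [apply|]; rewrite /K in l2 lK *; lia.
  rewrite -[leRHS]ger0_norm ?mulr_ge0 ?ler0n ?(ltW PP) // -sqrtr_sqr ler_wsqrtr //.
  rewrite exprMn; apply: ler_pM; rewrite ?ler0n //.
  - rewrite divr_ge0 ?(ltW h0) // sumr_ge0 // => a _.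
    by rewrite mulr_ge0 ?walk_ge0 //; apply: kernel_ge0.
  - by rewrite -natrX ler_nat leq_pmulr.
  apply: ltW; have := @coincide_small (l.-1 + l.-1).
  rewrite (_ : (2 * K - (l.-1 + l.-1))%N = (k.+1 - l.-1 + (k.+1 - l.-1))%N).
    by apply; rewrite /K in l2 lK *; lia.
  by rewrite /K in l2 lK *; lia.
apply/negP; rewrite -leNgt; apply: le_trans Nq.
rewrite /P /threshold -/N natrM invfM mulrCA divff ?mulr1 ?natrX ?exprVn //.
by rewrite pnatr_eq0 -lt0n addn_gt0 s_gt0 orbT.
Qed.

(** Union bound over [N] pairs. A pair outside [Q] counts 0, still below its share, so the
    inequality is strict even for empty [Q]. *)
Lemma sum_pairs_lt (Q : pred ('I_(2 * K) * 'I_(2 * K)))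
    (f : 'I_(2 * K) * 'I_(2 * K) -> R) :
  (forall p, Q p -> f p / walk_norm K < ((2 * N)%:R)^-1) ->
  \sum_(p | Q p) f p < walk_norm K / 2%:R.
Proof.
move=> fQ; have h0 := kernel_norm_gt0 K.
have N0 : 0 < (2 * N)%:R :> R by rewrite ltr0n muln_gt0.
rewrite big_mkcond /=.
apply: (@lt_le_trans _ _ (\sum_(p : 'I_(2 * K) * 'I_(2 * K))
    (walk_norm K / (2 * N)%:R))).
  apply: ltr_sum => [|p _]; last first.
    case: ifP => Qp; last by rewrite divr_gt0.
    by rewrite mulrC -ltr_pdivrMr // fQ.
  apply/hasP; exists (ord0, ord0) => //; exact: mem_index_enum.
rewrite sumr_const card_prod card_ord mulnn -/N -[X in X <= _]mulr_natr natrM.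
rewrite invfM [in leLHS]mulrC !mulrA le_eqVlt; apply/orP; left; apply/eqP.
have NN : N%:R != 0 :> R by rewrite pnatr_eq0.
by field; rewrite NN.
Qed.

Lemma induced_closed_walk : exists (a : V) (t : seq V),
  [/\ size t = (2 * K)%N, path e a t, last a t = a &
      forall i j, (i < j < 2 * K)%N ->
        nth a (a :: t) i != nth a (a :: t) j /\
        ((1 < j - i < 2 * K - 1)%N ->
           ~~ e (nth a (a :: t) i) (nth a (a :: t) j))].
Proof.
pose x a t i := nth a (a :: t) i : V.
pose I2 := ('I_(2 * K) * 'I_(2 * K))%type.
pose Q1 (p : I2) := (p.1 < p.2)%N.
(* Positions at difference 1 or [2 * K - 1] are consecutive on the cycle. *)
pose Q2 (p : I2) := (1 < p.2 - p.1 < 2 * K - 1)%N.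
pose G (A : rel V) a t (p : I2) : R :=
  (a == last a t)%:R * (A (x a t p.1) (x a t p.2))%:R.
(* On a closed walk [F] is 1 minus the number of bad pairs; elsewhere it is 0. Its total exceeds
   [h - h / 2 - h / 2], where [h] is [walk_norm K], so some closed walk has no bad pair. *)
pose F a t : R := (a == last a t)%:R
  - \sum_(p | Q1 p) G eq_op a t p - \sum_(p | Q2 p) G e a t p.
have G0 A a t p : 0 <= G A a t p by rewrite mulr_ge0 ?ler0n.
have sumG A (Q : pred I2) : (forall p, Q p -> Q1 p) ->
    \sum_a walk_sum kernel (2 * K) a (fun t => \sum_(p | Q p) G A a t p) =
    \sum_(p | Q p) chord A (p.2 - p.1) (2 * K - (p.2 - p.1)).
  move=> Q_lt; under eq_bigr => a _ do rewrite walk_sum_big.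
  rewrite exchange_big; apply: eq_bigr => -[i j] Qp.
  apply: closed_walk_pair; first exact: kernel_sym.
  by rewrite (ltnW (Q_lt _ Qp)) (ltnW (ltn_ord j)).
have F_gt0 : 0 < \sum_a walk_sum kernel (2 * K) a (F a).
  under eq_bigr => a _ do rewrite !walk_sumB.
  rewrite !sumrB !sumG //; last by move=> p /andP[]; rewrite /Q1; lia.
  have -> : \sum_a walk_sum kernel (2 * K) a (fun t => (a == last a t)%:R) =
      walk_norm K.
    rewrite (walk_norm_trace kernel_sym) addnn -mul2n; apply: eq_bigr => a _.
    rewrite (walk_sum_last _ _ _ (fun b => (a == b)%:R)).
    under eq_bigr => b _ do rewrite mulrC.
    by rewrite sum_delta.
  rewrite -addrA -opprD subr_gt0 [ltRHS](splitr (walk_norm K)).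
  apply: ltrD; apply: sum_pairs_lt => -[i j] /=.
    rewrite /Q1 /= => ij; apply: lt_le_trans (threshold_inv_le).
    have -> : chord eq_op (j - i) (2 * K - (j - i)) =
        coincide (j - i) (2 * K - (j - i)).
      by apply: eq_bigr => a _; rewrite sum_delta.
    apply: lt_le_trans (@coincide_small (j - i) _) _.
      by rewrite subn_gt0 ij (leq_ltn_trans (leq_subr _ _)).
    rewrite expr2 ler_piMr ?threshold_inv_le1 //; exact: ltW threshold_inv_gt0.
  by move=> Qij; apply: chord_small.
have [a Fa] : exists a, 0 < walk_sum kernel (2 * K) a (F a).
  apply/existsP; apply: contraLR F_gt0 => /existsPn Fa.
  by rewrite -leNgt sumr_le0 // => a _; rewrite leNgt Fa.
have [t [st pt Ft]] := walk_sum_gt0 kernel_ge0 Fa.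
have S0 A (Q : pred I2) : 0 <= \sum_(p | Q p) G A a t p by apply: sumr_ge0.
have at_last : a = last a t.
  apply/eqP; apply: contraTT Ft => /negPf na.
  by rewrite -leNgt /F na sub0r -opprD oppr_le0 addr_ge0.
have noG A (Q : pred I2) p : \sum_(p | Q p) G A a t p < 1 -> Q p ->
    ~~ A (x a t p.1) (x a t p.2).
  move=> lt1 Qp; apply: contraTN lt1 => Ap; rewrite -leNgt (bigD1 p) //=.
  by rewrite {1}/G -at_last eqxx Ap mul1r lerDl sumr_ge0.
have lt1 : 0 < 1 - \sum_(p | Q1 p) G eq_op a t p - \sum_(p | Q2 p) G e a t p.
  by have := Ft; rewrite /F -{1}at_last eqxx.
exists a, t; split=> // [|i j /andP[ij j2]].
  by apply: sub_path pt => b c; apply: kernel_gt0.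
have i2 := ltn_trans ij j2.
split=> [|Qij].
  apply: (noG eq_op Q1 (Ordinal i2, Ordinal j2)) => //.
  by have := S0 e Q2; lra.
apply: (noG e Q2 (Ordinal i2, Ordinal j2)) => //.
by have := S0 eq_op Q1; lra.
Qed.

End Sparse.

End InducedClosedWalk.

(** * Passing to a subgraph of large minimum degree *)

(** Take a smallest [S] spanning more than [2 * D * #|S|] ordered edges. Deleting a vertex with at
    most [D] neighbours would lose at most [2 * D] of them and leave a smaller dense set. *)
Lemma min_degree_subset (V : finType) (e : rel V) (D : nat) : symmetric e ->
  2 * D * #|V| < #|[set p : V * V | e p.1 p.2]| ->
  exists2 S : {set V}, S != set0 & {in S, forall x, D < #|[set y in S | e x y]|}.
Proof.
move=> e_sym.
pose c (S : {set V}) := #|[set p : V * V | [&& p.1 \in S, p.2 \in S & e p.1 p.2]]|.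
pose dense (S : {set V}) := 2 * D * #|S| < c S.
move=> many; have : dense setT.
  rewrite /dense /c cardsT; apply: leq_trans many _; apply: subset_leq_card.
  by apply/subsetP => p; rewrite !inE.
case/(@arg_minnP _ _ dense (fun S : {set V} => #|S|)) => S S_dense S_min.
exists S => [|x xS].
  apply: contraTneq S_dense => ->; rewrite /dense /c -leqNgt.
  by rewrite (_ : [set _ | _] = set0) ?cards0 //; apply/setP => p; rewrite !inE.
set N := [set y in S | e x y].
have cS : c S <= c (S :\ x) + #|N| + #|N|.
  have sub : [set p : V * V | [&& p.1 \in S, p.2 \in S & e p.1 p.2]] \subset
     [set p : V * V | [&& p.1 \in S :\ x, p.2 \in S :\ x & e p.1 p.2]]
     :|: [set (x, y) | y in N] :|: [set (y, x) | y in N].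
    apply/subsetP => -[a b]; rewrite !inE /= => /and3P[aS bS ab].
    have [ax|ax] := eqVneq a x.
      apply/orP; left; apply/orP; right; apply/imsetP; exists b; last by rewrite ax.
      by rewrite inE bS -ax.
    have [bx|bx] := eqVneq b x; last by rewrite aS bS ab.
    apply/orP; right; apply/imsetP; exists a; last by rewrite bx.
    by rewrite inE aS e_sym -bx.
  apply: leq_trans (subset_leq_card sub) _.
  apply: leq_trans (leq_card_setU _ _) _; apply: leq_add (leq_imset_card _ _).
  apply: leq_trans (leq_card_setU _ _) _; exact: leq_add (leq_imset_card _ _).
have : ~~ dense (S :\ x).
  by apply/negP => /S_min; rewrite (cardsD1 x S) xS; lia.
move: S_dense; rewrite /dense (cardsD1 x S) xS; nia.
Qed.

(** * Induced cycles and edge counts in simple graphs *)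

Section SimpleGraphs.
Variables (n : nat) (E : {set 'I_n * 'I_n}).
Hypothesis E_simple : simple_graph E.
Let e : rel 'I_n := fun x y => (x, y) \in E.

Lemma simple_sym : symmetric e.
Proof. by move=> x y; case/andP: E_simple => /forallP/(_ x)/forallP/(_ y)/eqP. Qed.

Lemma simple_irr x : e x x = false.
Proof. by case/andP: E_simple => _ /forallP/(_ x)/negPf. Qed.

Lemma nedges_ordered : 2 * nedges E <= #|[set p : 'I_n * 'I_n | e p.1 p.2]|.
Proof.
rewrite mul2n -addnn /nedges; set L := [set p in E | _].
pose swap (p : 'I_n * 'I_n) := (p.2, p.1).
have swap_inj : injective swap by move=> [a b] [a' b'] [-> ->].
rewrite -{2}(card_imset L swap_inj) -cardsUI.
have -> : L :&: [set swap p | p in L] = set0.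
  apply/setP => p; rewrite [in RHS]inE; apply/negP => /setIP[].
  rewrite inE => /andP[_ lt] /imsetP[[a b]]; rewrite inE => /andP[_ /= lt'] pE.
  by move: lt; rewrite pE /=; lia.
rewrite cards0 addn0; apply/subset_leq_card/subsetP => p /setUP[|/imsetP[q]].
  by rewrite !inE /e -surjective_pairing => /andP[].
by rewrite inE => /andP[qE _] ->; rewrite inE /= simple_sym /e -surjective_pairing.
Qed.

(** The images of [f] and [s] of their common neighbours form a [K_{s,s}]; the sides are disjoint
    because there are no loops. *)
Lemma few_common_neighbors (S : {set 'I_n}) s : ~~ contains_Kss s E ->
  forall f : {ffun 'I_s -> {x | x \in S}}, injective f ->
  #|[set b : {x | x \in S} | [forall m, e (val (f m)) (val b)]]| <= s.
Proof.
move=> noK f f_inj; rewrite leqNgt; apply: contra noK => /ltnW/card_geqP[B [uB sB subB]].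
apply/existsP; exists [set val (f m) | m : 'I_s].
apply/existsP; exists [set val b | b in B].
have AB a b : a \in [set val (f m) | m : 'I_s] -> b \in [set val b | b in B] -> e a b.
  by case/imsetP=> m _ -> /imsetP[c /subB]; rewrite inE => /forallP/(_ m) ? ->.
apply/and4P; split.
- rewrite card_imset ?card_ord // => i j /val_inj; exact: f_inj.
- by rewrite card_imset; [rewrite (card_uniqP uB) sB|apply: val_inj].
- rewrite -setI_eq0; apply/eqP/setP => z; rewrite [in RHS]inE; apply/negP.
  by move=> /setIP[zA zB]; have := AB z z zA zB; rewrite simple_irr.
- by apply/forall_inP => a aA; apply/forall_inP => b; apply: AB.
Qed.

Lemma induced_cycle_of_walk m (x : nat -> 'I_n) : 2 < m ->
  (forall i, i < m -> e (x i) (x i.+1)) -> x m = x 0 ->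
  (forall i j, i < j < m -> x i != x j /\ (1 < j - i < m - 1 -> ~~ e (x i) (x j))) ->
  contains_induced (cycle_graph m) E.
Proof.
move=> m_gt2 x_path x_closed x_ind; apply/existsP; exists [ffun i : 'I_m => x i].
have lt_eq (i j : 'I_m) : i < j -> ((i, j) \in cycle_graph m) = e (x i) (x j).
  move=> ij; have jm := ltn_ord j; rewrite inE /=.
  rewrite (modn_small (leq_ltn_trans ij jm)).
  have [->|j_ne] := eqVneq (val j) (val i).+1.
    by rewrite x_path // (ltn_trans ij).
  (* The wraparound: the last index is adjacent to 0, and that edge is the closing step of the
     walk. *)
  have [jm1|jm1] := eqVneq (val j).+1 m.
    rewrite jm1 modnn; have [i0|i0] := eqVneq (val i) 0.
      by rewrite i0 -x_closed -(congr1 x jm1) simple_sym x_path.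
    apply/esym/negbTE; apply (x_ind i j); first by rewrite ij.
    by move: i0 j_ne jm1; rewrite /=; lia.
  rewrite modn_small; last by rewrite ltn_neqAle jm1.
  rewrite (_ : (val i == _) = false); last by apply/eqP => /=; lia.
  apply/esym/negbTE; apply (x_ind i j); first by rewrite ij.
  by move: j_ne jm1; rewrite /=; lia.
have cyc_sym (i j : 'I_m) : ((i, j) \in cycle_graph m) = ((j, i) \in cycle_graph m).
  by rewrite !inE /= orbC.
apply/andP; split.
  apply/injectiveP => i j; rewrite !ffunE => xij; apply: val_inj => /=.
  case: (ltngtP i j) => // lt.
    by have [] := x_ind i j; rewrite ?lt ?xij ?eqxx ?ltn_ord.
  by have [] := x_ind j i; rewrite ?lt ?xij ?eqxx ?ltn_ord.
apply/forallP => i; apply/forallP => j; rewrite !ffunE; apply/eqP.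
case: (ltngtP i j) => [lt|lt|/val_inj ->].
- exact: lt_eq.
- by rewrite cyc_sym lt_eq // simple_sym.
rewrite -/(e _ _) simple_irr inE /= orbb; apply/eqP => jE.
have jm := ltn_ord j; have [jm1|jm1] := eqVneq (val j).+1 m.
  by move: jE; rewrite jm1 modnn /=; move: jm1 => /=; lia.
by move: jE; rewrite modn_small ?ltn_neqAle ?jm1 //; lia.
Qed.

Lemma nedges_bound (R : rcfType) k s : 1 < k -> 0 < s ->
  ~~ contains_Kss s E -> ~~ contains_induced (cycle_graph (2 * k)) E ->
  nedges E ^ k <= threshold k s ^ (4 * k) * n ^ k.+1.
Proof.
move=> k_gt1 s_gt0 noK noC.
have [->|e_gt0] := posnP (nedges E); first by rewrite exp0n // ltnW.
have n_gt0 : 0 < n.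
  rewrite lt0n; apply: contraTneq e_gt0 => n0.
  rewrite -leqNgt leqn0 cards_eq0; apply/eqP/setP => -[a b].
  by suff: a < 0 by []; rewrite -[leqRHS]n0.
(* Rounding this way gives [D * n < nedges E <= D.+1 * n]: the strict bound yields minimum degree
   [D.+1], the other turns a bound on [D.+1] into one on the edges. *)
pose D := (nedges E).-1 %/ n.
have DE : D * n < nedges E by rewrite -(ltn_predK e_gt0) ltnS leq_trunc_div.
have ED : nedges E <= D.+1 * n by rewrite -(ltn_predK e_gt0) ltn_ceil.
have [|S S_neq0 S_deg] := @min_degree_subset _ e D simple_sym.
  rewrite card_ord; apply: leq_trans nedges_ordered; lia.
pose V : finType := {x | x \in S}; pose eS : rel V := fun a b => e (val a) (val b).
have card_V : #|V| = #|S| by rewrite card_sig; apply: eq_card => x; rewrite inE.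
have V_gt0 : 0 < #|V| by rewrite card_V card_gt0.
have eS_deg (a : V) : D.+1 <= #|eS a|.
  apply: leq_trans (S_deg _ (valP a)) _.
  rewrite -(card_imset _ val_inj); apply/subset_leq_card/subsetP => y.
  rewrite inE => /andP[yS ay]; apply/imsetP; exists (Sub y yS : V) => //.
have [big|small] := ltnP (threshold k s ^ (4 * k) * #|V|) (D.+1 ^ k); last first.
  apply: (@leq_trans ((D.+1 * n) ^ k)); first by rewrite leq_exp2r // ltnW.
  rewrite expnMn expnS mulnA leq_mul //; apply: leq_trans small _.
  by rewrite leq_mul // card_V -[leqRHS]card_ord max_card.
case/negP: noC; case: k k_gt1 big => // k k_gt1 big.
have [a [t [st pt last_t ind]]] := induced_closed_walk R (fun x y => simple_sym _ _)
  (ltn0Sn D) eS_deg V_gt0 s_gt0 big (few_common_neighbors noK).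
pose x i := val (nth a (a :: t) i).
apply: (induced_cycle_of_walk (x := x)); first by lia.
- move=> i im; have := pathP a pt i; rewrite st => /(_ im); exact.
- by rewrite /x -st -last_nth last_t.
by move=> i j /ind; rewrite /x (inj_eq val_inj).
Qed.

End SimpleGraphs.

Lemma ex_star_bound k s n : 1 < k -> 0 < s ->
  ex_star n (cycle_graph (2 * k)) s ^ k <= threshold k s ^ (4 * k) * n ^ k.+1.
Proof.
move=> k_gt1 s_gt0; rewrite /ex_star.
apply: (big_ind (fun m => m ^ k <= _)) => [|x y xb yb|E].
- by rewrite exp0n // ltnW.
- by rewrite /maxn; case: ifP.
by case/andP=> /andP[Es noK] noC; apply: (nedges_bound Es Rdefinitions.R).
Qed.

(* Taking [k]-th roots in the reals *)
From Stdlib Require Import Reals.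

Lemma INR_expn m k : INR (expn m k) = (INR m ^ k)%R.
Proof. by elim: k => // k IHk; rewrite expnS mult_INR IHk. Qed.

Lemma INR_root_bound k a m n : 0 < k -> 0 < a -> 0 < n ->
  expn m k <= a * expn n k.+1 ->
  (INR m <= Rpower (INR a) (/ INR k) * Rpower (INR n) (1 + / INR k))%R.
Proof.
move=> k_gt0 a_gt0 n_gt0 bound.
have pos i : 0 < i -> (0 < INR i)%R by move=> /ssrnat.ltP; apply: lt_0_INR.
have k_neq0 : INR k <> 0%R by apply: not_0_INR => k0; rewrite k0 in k_gt0.
(* [Rpower] is an exponential, positive even at base 0, so [m = 0] cannot be written as a root. *)
have [->|m_gt0] := posnP m.
  by apply: Rmult_le_pos; apply/Rlt_le/exp_pos.
have -> : INR m = Rpower (INR (expn m k)) (/ INR k).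
  rewrite INR_expn -Rpower_pow ?Rpower_mult; last exact: pos.
  by rewrite Rinv_r // Rpower_1 //; apply: pos.
have -> : Rpower (INR n) (1 + / INR k) = Rpower (INR (expn n k.+1)) (/ INR k).
  rewrite INR_expn -Rpower_pow ?Rpower_mult; last exact: pos.
  by congr Rpower; rewrite S_INR; field.
rewrite Rpower_mult_distr; try by apply: pos; rewrite ?expn_gt0 ?n_gt0.
rewrite -mult_INR; apply: Rle_Rpower_l.
  by apply/Rlt_le/Rinv_0_lt_compat/pos.
split; first by apply: pos; rewrite expn_gt0 m_gt0.
by apply: le_INR; apply/ssrnat.leP.
Qed.

Theorem theorem1p4 (k s : nat) (hk : (2 <= k)%N) (hs : (2 <= s)%N) :
  exists C : R, forall n : nat, (0 < n)%N ->
    (INR (ex_star n (cycle_graph (2 * k)) s) <=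
       C * Rpower (INR n) (1 + / INR k))%R.
Proof.
(* This is the fourth power of [threshold k s]. *)
exists (Rpower (INR (expn (threshold k s) (4 * k))) (/ INR k)) => n n_gt0.
have k_gt0 : 0 < k := ltnW hk; have s_gt0 : 0 < s := ltnW hs.
apply: INR_root_bound (ex_star_bound n hk s_gt0) => //.
by rewrite expn_gt0 threshold_gt0.
Qed.
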